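(* Let $q\in\mathbb{R}$ be arbitrary and suppose that the function $f:]0,1]\rightarrow\mathbb{R}$ satisfies $$f(xy)+f((1-x)y)-f(y)=\left(f(x)+f(1-x)\right)y^{q}$$ for all $x\in ]0,1[$ and $y\in ]0,1]$. (1) If $q\neq 1$, assume further that one of the following is true: (i) $f$ is bounded above or bounded below on a subset of $]0,1[$ that has positive Lebesgue measure; (ii) $f$ is Lebesgue measurable. Then there exist $c,c^{\ast}\in\mathbb{R}$ such that $$f(x)=\begin{cases} c^{\ast}x+cx^{q}, & \text{if } x\in ]0,1[,\\ 0, & \text{if } x=1.\end{cases}$$ (2) If $q=1$, suppose additionally that one of the following holds: (i) $f$ is bounded (above and below) on a subset of $]0,1[$ that has positive Lebesgue measure; (ii) $f$ is Lebesgue measurable. Then there exist $c,c^{\ast}\in\mathbb{R}$ such that $$f(x)=\begin{cases} cx\ln(x)+c^{\ast}x, & \text{if } x\in ]0,1[,\\ 0, & \text{if } x=1.\end{cases}$$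
   Context: The notation $]a,b[$ and $]a,b]$ denotes open and left-open, right-closed intervals. *)

(* Defs.v *)
From HB Require Import structures.
From mathcomp Require Import all_boot all_order all_algebra.
From mathcomp Require Import all_classical all_reals all_analysis.

Set Implicit Arguments.
Unset Strict Implicit.
Unset Printing Implicit Defensive.

Import Order.TTheory GRing.Theory Num.Theory.
Import numFieldNormedType.Exports.

Local Open Scope classical_set_scope.
Local Open Scope ring_scope.

(* The canonical sigma-algebra on [R] is the Borel one. The Lebesgue
   sigma-algebra, on which [completed_lebesgue_measure] is defined, is the one
   of the Caratheodory-measurable sets for the Lebesgue outer measure. *)
Definition lebesgueType (R : realType) : measurableType _ :=
  caratheodory_type ((@wlength R idfun)^*)%mu.

Definition lebesgue_measurable (R : realType) (A : set R) : Prop :=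
  measurable (A : set (lebesgueType R)).

Definition lebesgue_measurable_fun (R : realType) (D : set R) (f : R -> R) :
    Prop :=
  @measurable_fun _ _ (lebesgueType R) (measurableTypeR R) D f.

Definition positive_lebesgue_measure (R : realType) (A : set R) : Prop :=
  lebesgue_measurable A /\ (0%E < completed_lebesgue_measure A)%E.

(* A function f : ]0,1] -> R is represented by a total function on R whose
   values outside ]0,1] are never used. *)
Definition entropy_equation (R : realType) (q : R) (f : R -> R) : Prop :=
  forall x y : R, 0 < x < 1 -> 0 < y <= 1 ->
    f (x * y) + f ((1 - x) * y) - f y = (f x + f (1 - x)) * y `^ q.

(* Main.v *)
Require Import Defs.
From HB Require Import structures.
From mathcomp Require Import all_boot all_order all_algebra.
From mathcomp Require Import all_classical all_reals all_analysis.
From mathcomp Require Import measurable_realfun.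
From mathcomp Require Import ring lra.

Set Implicit Arguments.
Unset Strict Implicit.
Unset Printing Implicit Defensive.

Import Order.TTheory GRing.Theory Num.Theory.
Import numFieldNormedType.Exports.

Local Open Scope classical_set_scope.
Local Open Scope ring_scope.

(** Put [x := u / (u + v)] and [y := u + v] in the equation: it says that the
    Cauchy difference [f u + f v - f (u + v)] is homogeneous of degree [q].
    Hence for each [t] in ]0,1] the homogeneity defect
    [A_t x := f (t * x) - t `^ q * f x] has zero Cauchy difference, i.e. it is
    additive on ]0,1] ([additive_homogeneity_defect]).  Taking [y = 1] gives
    [f 1 = 0], so that [A_t 1 = f t].

    If [q <> 1], the symmetry of [f (r * t)] in [r] and [t] gives
    [A_r t - t `^ q * A_r 1 = A_t r - r `^ q * f t].  For [r = 1/2] additivity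
    yields [A_t r = r * f t], and as [r <> r `^ q] one can solve for [f]:
    [f t = a t - a 1 * t `^ q] with [a] additive
    ([entropy_equation_power]).  A one-sided bound on [f] over a set of
    positive measure is then a one-sided bound on [a] over a smaller such set
    where [t `^ q] is bounded, which forces [a] to be linear.

    If [q = 1] no single [r] suffices.  Instead let [|f| <= M] on a set [B] of
    positive measure.  For [t] close to 1 the set of the [x] in [B] with
    [t * x] in [B] still has positive measure, and [A_t] is bounded there, so
    [A_t] is linear, which is the Leibniz rule
    [f (t * x) = t * f x + x * f t].  The [t] that satisfy this rule are stable
    under powers, so it holds for all [t], and [f x / x] turns products into
    sums.  It is bounded near 1, so it is a multiple of the logarithm.

    Both cases rest on [additive_on_unit_linear_of_ubound] (an additive function
    on ]0,1] with a one-sided bound on a set of positive measure is linear) and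
    on a version of the theorem of Steinhaus for affine maps,
    [affine_steinhaus], which is drawn from the Lebesgue density theorem.
    Measurability of [f] is reduced to boundedness, since [|f| <= n] must hold
    on a set of positive measure for some [n]. *)

(** * Additive functions on the unit interval *)

Definition additive_on_unit (R : realType) (a : R -> R) : Prop :=
  forall u v : R, 0 < u -> 0 < v -> u + v <= 1 -> a (u + v) = a u + a v.

Lemma additive_on_unit_mulrn (R : realType) (a : R -> R) (n : nat) (u : R) :
  additive_on_unit a -> 0 < u -> u *+ n.+1 <= 1 -> a (u *+ n.+1) = a u *+ n.+1.
Proof.
move=> ha u0; elim: n => [//|n IH]; rewrite mulrS => h.
rewrite ha ?pmulrn_lgt0// IH -?mulrS//.
by apply: le_trans h; rewrite lerDr ltW.
Qed.

Lemma additive_on_unit_half (R : realType) (a : R -> R) (u : R) :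
  additive_on_unit a -> 0 < u <= 1 -> a (2^-1 * u) = 2^-1 * a u.
Proof.
move=> ha u01; have := ha (2^-1 * u) (2^-1 * u).
have -> : 2^-1 * u + 2^-1 * u = u by field.
by move=> h; rewrite h; [field|lra..].
Qed.

(** The difference [b] with the linear function [a 1 * x] vanishes at 1, hence
    at all [1 / N], so it is bounded on all of ]0,1] by its bound near 0.
    Doubling the argument modulo 1 doubles [b], and a bounded function with this
    property is zero. *)
Lemma additive_on_unit_linear (R : realType) (a : R -> R) (d K : R) :
  additive_on_unit a -> 0 < d -> (forall h, 0 < h < d -> `|a h| <= K) ->
  forall x, 0 < x <= 1 -> a x = a 1 * x.
Proof.
move=> ha d0 hK.
pose b x := a x - a 1 * x.
have hb : additive_on_unit b.
  by move=> u v u0 v0 uv; rewrite /b ha//; ring.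
have b1 : b 1 = 0 by rewrite /b; ring.
have bK h : 0 < h < d -> h <= 1 -> `|b h| <= K + `|a 1|.
  move=> hd h1; rewrite /b (le_trans (ler_normB _ _))// lerD ?hK//.
  by rewrite normrM ler_piMr// ger0_norm//; lra.
set K' := K + `|a 1| in bK.
(* For [1 / N < d], the [1 / N]-periodicity of [b] carries the bound on
   ]0,1/N] to ]0,1]. *)
pose N := Num.bound d^-1.
have Nd : d^-1 < N%:R by rewrite archi_boundP// ltW// invr_gt0.
have N0 : 0 < N%:R :> R by apply: lt_trans Nd; rewrite invr_gt0.
case: N Nd N0 => [|N]; first by rewrite ltxx.
move=> Nd N0; pose e : R := N.+1%:R^-1.
have e0 : 0 < e by rewrite invr_gt0.
have eN : e *+ N.+1 = 1 by rewrite -mulr_natr mulVf// gt_eqF.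
have ed : e < d by rewrite invf_plt.
have be : b e = 0.
  have := additive_on_unit_mulrn (n := N) hb e0; rewrite eN b1 lexx.
  by move=> /(_ isT)/esym/eqP; rewrite mulrn_eq0/= => /eqP.
have e1 : e <= 1 by rewrite -eN mulrS lerDl mulrn_wge0// ltW.
have bbnd x : 0 < x <= 1 -> `|b x| <= K'.
  suff H n : forall x, 0 < x <= 1 -> x <= e *+ n.+1 -> `|b x| <= K'.
    by move=> x01; apply: (H N) => //; rewrite eN; case/andP : x01.
  elim: n => [|n IH] {}x x01; first by rewrite mulr1n => xe; apply: bK; lra.
  rewrite mulrS => xe; have [xle|ex] := leP x e; first by apply: bK; lra.
  have -> : b x = b (x - e).
    by rewrite -{1}(subrK e x) hb ?be ?addr0//; lra.
  by apply: IH; lra.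
(* Since [b (1 / 2) = 0], the value [2 * b x] is taken at [2 * x] or at
   [2 * x - 1], whichever is in ]0,1]. *)
have b2 : b (2^-1) = 0.
  have := @additive_on_unit_half _ _ 1 hb; rewrite mulr1 b1 mulr0; apply; lra.
have bpow n : forall x, 0 < x <= 1 -> `|b x| * 2 ^+ n <= K'.
  elim: n => [|n IH] x x01; first by rewrite expr0 mulr1 bbnd.
  have small y : 0 < y <= 2^-1 -> `|b y| * 2 ^+ n.+1 <= K'.
    move=> y2; have := IH (y + y); rewrite hb; [|lra..].
    rewrite -(mulr2n (b y)) normrMn exprS => h.
    have /h : 0 < y + y <= 1 by lra.
    by congr (_ <= _); ring.
  have [xle|ex] := leP x 2^-1; first by apply: small; lra.
  have -> : b x = b (x - 2^-1).
    by rewrite -{1}(subrK 2^-1 x) hb ?b2 ?addr0//; lra.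
  by apply: small; lra.
move=> x x01; suff : b x = 0 by rewrite /b; lra.
apply/eqP/negP => /negP bx0.
have bx : 0 < `|b x| by rewrite normr_gt0.
have K0 : 0 <= K' by apply: le_trans (bbnd x x01).
have : K' / `|b x| < 2 ^+ Num.bound (K' / `|b x|).
  apply: (lt_trans (archi_boundP _)); first by rewrite divr_ge0.
  by rewrite -natrX ltr_nat ltn_expl.
by rewrite ltr_pdivrMr// ltNge mulrC bpow.
Qed.

(** * Affine images of sets of positive Lebesgue measure *)

Lemma measure_bigcup_gt0 d (T : measurableType d) (R : realType)
    (mu : {measure set T -> \bar R}) (F : (set T)^nat) :
  (forall n, measurable (F n)) -> (0 < mu (\bigcup_n F n))%E ->
  exists n, (0 < mu (F n))%E.
Proof.
move=> mF; apply: contraPP => /forallNP F0; apply/negP.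
rewrite -leNgt le_eqVlt; apply/orP; left; apply/eqP.
apply/(negligibleP mu); first exact: bigcupT_measurable.
apply: negligible_bigcup => n; apply/(negligibleP mu) => //.
by apply/eqP; rewrite eq_le measure_ge0 andbT leNgt; apply/negP; exact: F0.
Qed.

(** [D] is the countable union of its parts where [|g| <= n], and these cannot
    all be null. *)
Lemma positive_measure_bounded d (T : measurableType d) (R : realType)
    (mu : {measure set T -> \bar R}) (D : set T) (g : T -> R) :
  measurable D -> measurable_fun D (g : T -> measurableTypeR R) ->
  (0 < mu D)%E ->
  exists n : nat, let E := D `&` [set x | `|g x| <= n%:R] in
    measurable E /\ (0 < mu E)%E.
Proof.
move=> mD mg D0; pose F (n : nat) := D `&` [set x | `|g x| <= n%:R].
have mF n : measurable (F n).
  have -> : F n = D `&` g @^-1` `[(- n%:R : R), (n%:R : R)].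
    apply/seteqP; split=> x [Dx gx]; split => //;
      by move: gx; rewrite /= in_itv/= -ler_norml.
  by apply: mg => //; exact: measurable_itv.
have [|n Fn] := @measure_bigcup_gt0 _ _ _ mu _ mF; last by exists n; split; [exact: mF|exact: Fn].
suff -> : \bigcup_n F n = D by [].
apply/seteqP; split=> [x [n _ []]//|x Dx].
by exists (Num.bound `|g x|) => //; split => //=; rewrite ltW// archi_boundP.
Qed.

Lemma measurable_affine (R : realType) (al be : R) :
  measurable_fun [set: measurableTypeR R]
    (fun x : R => al * x + be : measurableTypeR R).
Proof.
by apply: measurable_funD => //; apply: measurable_funM.
Qed.

(** Both sides are measures in [A], and they agree on the intervals ]a,b]. *)
Lemma lebesgue_measure_affine (R : realType) (al be : R) (A : set R) :
  al != 0 -> measurable A ->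
  (lebesgue_measure A =
   `|al|%:E * lebesgue_measure ((fun x => al * x + be)%R @^-1` A))%E.
Proof.
move=> al0 mA.
pose T (x : measurableTypeR R) : measurableTypeR R := al * x + be.
have mT : measurable_fun setT T by exact: measurable_affine.
transitivity (pushforward (mscale `|al|%:nng (@lebesgue_measure R)) T A) => //.
apply: lebesgue_measure_unique => // _ [[a b]] _ <-.
rewrite -[RHS]/(`|al|%:E * lebesgue_measure (T @^-1` `]a, b]))%E.
have [al_gt0|al_lt0|al_eq0] := ltgtP 0 al; last by rewrite -al_eq0 eqxx in al0.
- have -> : T @^-1` `]a, b] = `](a - be) / al, (b - be) / al]%classic.
    apply/seteqP; split => x /=; rewrite !in_itv/= /T.
      by rewrite ltr_pdivrMr// ler_pdivlMr//; lra.
    by rewrite ltr_pdivrMr// ler_pdivlMr//; lra.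
  rewrite !lebesgue_measure_itv/= !lte_fin ltr_pM2r ?invr_gt0// ltrD2r.
  case: ifPn => ab; rewrite ?mule0// -!EFinD -EFinM; congr EFin.
  by rewrite gtr0_norm//; field.
- have -> : T @^-1` `]a, b] = `[(b - be) / al, (a - be) / al[%classic.
    apply/seteqP; split => x /=; rewrite !in_itv/= /T.
      by rewrite ltr_ndivlMr// ler_ndivrMr//; lra.
    by rewrite ltr_ndivlMr// ler_ndivrMr//; lra.
  rewrite !lebesgue_measure_itv/= !lte_fin ltr_nM2r ?invr_lt0// ltrD2r.
  case: ifPn => ab; rewrite ?mule0// -!EFinD -EFinM; congr EFin.
  by rewrite ltr0_norm//; field; rewrite lt_eqF.
Qed.

Lemma measure_setI_gt0 d (T : measurableType d) (R : realType)
    (mu : {measure set T -> \bar R}) (D E F : set T) :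
  measurable D -> measurable E -> measurable F -> E `<=` D -> F `<=` D ->
  (mu D < mu E + mu F)%E -> (0 < mu (E `&` F))%E.
Proof.
move=> mD mE mF ED FD Dlt; rewrite ltNge; apply/negP => EF0.
have {}EF0 : mu (E `&` F) = 0%E by apply/eqP; rewrite eq_le EF0 measure_ge0.
have Eoo : (mu E < +oo)%E.
  apply: le_lt_trans (lt_le_trans Dlt (leey _)).
  by apply: le_measure; rewrite ?inE.
have := measureUfinl mE mF Eoo; rewrite EF0 sube0 => EUF.
move: Dlt; rewrite -EUF ltNge => /negP; apply.
by apply: le_measure; rewrite ?inE//; [exact: measurableU|rewrite subUset].
Qed.

(** At a density point of [B] the balls are eventually filled by [B] up to any
    ratio below 1.  The ratio 3/4 is chosen so that two such sets cannot be
    disjoint inside a ball that is larger by a factor 5/4. *)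
Lemma density_point (R : realType) (B : set R) :
  measurable B -> (0 < lebesgue_measure B)%E ->
  exists p r : R, [/\ B p, 0 < r &
    ((3 / 2 * r)%:E < lebesgue_measure (B `&` ball p r))%E].
Proof.
move=> mB B0.
have [N [mN N0 BN]] := lebesgue_density mB.
have [p [Bp Np]] : exists p, B p /\ ~ N p.
  apply/not_existsP => H; move: B0; rewrite ltNge => /negP; apply.
  rewrite -N0; apply: le_measure; rewrite ?inE// => x Bx.
  by apply: contrapT => Nx; apply: (H x).
have {BN} : (lebesgue_measure (B `&` ball p r) / lebesgue_measure (ball p r))%E
    @[r --> 0^'+] --> (\1_B p)%:E by apply: contrapT => /BN.
rewrite indicE mem_set//= => /(_ [set y | (3 / 4)%:E < y]%E) H.
have {}H : \forall r \near 0^'+, ((3 / 4)%:E <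
    lebesgue_measure (B `&` ball p r) / lebesgue_measure (ball p r))%E.
  apply: H; apply: open_nbhs_nbhs; split; first exact: open_ereal_gt_ereal.
  by rewrite /= lte_fin; lra.
have [r [r0 Hr]] : exists r : R, 0 < r /\ ((3 / 4)%:E <
    lebesgue_measure (B `&` ball p r) / lebesgue_measure (ball p r))%E.
  apply: (@filter_ex _ (0^'+ : set_system R)).
  by apply: filterI => //; exact: nbhs_right_gt.
exists p, r; split => //.
move: Hr; rewrite lebesgue_measure_ball ?(ltW r0)//.
rewrite inver mulrn_eq0/= gt_eqF// lte_pdivlMr ?pmulrn_lgt0// -EFinM.
by congr (_%:E < _)%E; field.
Qed.

(** For [al] near [1] this gives the multiplicative form of the theorem of
    Steinhaus (with [be = 0]), and for [al = -1] the form about the sums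
    [x + y = be] of two elements of [B].  The reason is the same for both: the
    affine map almost fixes a density point [p] of [B], and the preimage of a
    small portion of [B] around [p] is no smaller than this portion and stays
    inside a slightly larger ball. *)
Lemma affine_steinhaus (R : realType) (B : set R) :
  measurable B -> (0 < lebesgue_measure B)%E ->
  exists p e : R, [/\ B p, 0 < e & forall al be : R,
    1 - e <= `|al| <= 1 -> `|al * p + be - p| <= e ->
    (0 < lebesgue_measure (B `&` (fun x => al * x + be)%R @^-1` B))%E].
Proof.
move=> mB B0; have [p [r [Bp r0 Er]]] := density_point mB B0.
(* The preimage of [ball p r] lies in the ball of radius [(r + e) / (1 - e)],
   which is at most [5 / 4 * r] for this [e]. *)
pose e := Num.min (10^-1) (r / 8).
have e10 : e <= 10^-1 by rewrite ge_min lexx.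
have er : e <= r / 8 by rewrite ge_min lexx orbT.
exists p, e; split => //; first by rewrite lt_min; lra.
move=> al be /andP[al1 al2] hp.
have al0 : al != 0 by rewrite -normr_gt0; lra.
pose T (x : R) := al * x + be.
have mT (A : set R) : measurable A -> measurable (T @^-1` A).
  by move=> mA; rewrite -[X in measurable X]setTI; exact: measurable_affine.
pose E := B `&` ball p r.
have mE : measurable E by apply: measurableI => //; exact: measurable_ball.
have EF : (0 < lebesgue_measure (E `&` T @^-1` E))%E.
  apply: (measure_setI_gt0 (mu := @lebesgue_measure R)
      (D := ball p (5 / 4 * r) : set R)).
  - exact: measurable_ball.
  - exact: mE.
  - exact: mT.
  - by apply: subset_trans (@subIsetr _ _ _) _; apply: le_ball; lra.
  - move=> x [_]; rewrite /T /ball/= => hx.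
    have : `|al| * `|p - x| <= `|al * p + be - p| + `|p - (al * x + be)|.
      by rewrite -normrM (le_trans _ (ler_normD _ _))//;
        rewrite le_eqVlt; apply/orP; left; apply/eqP; congr (`|_|); ring.
    have : 9 / 10 * `|p - x| <= `|al| * `|p - x| by rewrite ler_wpM2r//; lra.
    by lra.
  - have muD : lebesgue_measure (ball p (5 / 4 * r)) = ((5 / 4 * r) *+ 2)%:E.
      by apply: lebesgue_measure_ball; lra.
    rewrite [ltLHS]muD.
    have FE : (lebesgue_measure E <= lebesgue_measure (T @^-1` E))%E.
      by rewrite (lebesgue_measure_affine be al0 mE) gee_pMl.
    apply: lt_le_trans (leeD2l _ FE).
    by apply: lt_trans (lteD Er Er); rewrite -EFinD lte_fin; lra.
apply: lt_le_trans EF _; apply: le_measure; rewrite ?inE.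
- by apply: measurableI => //; exact: mT.
- by apply: measurableI => //; exact: mT.
- by move=> x [[Bx _] [Tx _]].
Qed.

(** * Lebesgue measurable sets and functions *)

Lemma borel_lebesgue_measurable (R : realType) (A : set (measurableTypeR R)) :
  measurable A -> lebesgue_measurable A.
Proof.
move=> mA; exact: sub_caratheodory.
Qed.

(** A Lebesgue measurable set is the union of a Borel set and a null set. *)
Lemma positive_lebesgue_borel_subset (R : realType) (A : set R) :
  positive_lebesgue_measure A ->
  exists B : set R, [/\ measurable B, B `<=` A & (0 < lebesgue_measure B)%E].
Proof.
case=> mA A0.
have : (completed_algebra_gen (@lebesgue_measure R)) A.
  by rewrite -g_sigma_completed_algebra_genE completed_caratheodory_measurable.
case=> B mB [N negN] BNA.
exists B; split => //; first by rewrite -BNA; exact: subsetUl.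
have N0 := (negligible_outer_measure N).1 negN.
apply: lt_le_trans A0 _; rewrite -BNA.
by have := outer_measureU2 (wlength idfun)^*%mu B N; rewrite [X in (_ + X)%E]N0 adde0.
Qed.

Lemma lebesgue_measurable_bounded (R : realType) (f : R -> R) :
  lebesgue_measurable_fun `]0, 1]%classic f ->
  exists A : set R, [/\ A `<=` `]0, 1[%classic,
    positive_lebesgue_measure A & has_ubound (f @` A) /\ has_lbound (f @` A)].
Proof.
move=> mf.
have mI : lebesgue_measurable (`]0, 1[%classic : set R).
  by apply: borel_lebesgue_measurable; exact: measurable_itv.
have mI1 : lebesgue_measurable (`]0, 1]%classic : set R).
  by apply: borel_lebesgue_measurable; exact: measurable_itv.
have I0 : (0 < completed_lebesgue_measure (`]0%R, 1%R[%classic : set R))%E.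
  have -> : completed_lebesgue_measure (`]0%R, 1%R[%classic : set R) =
            lebesgue_measure (`]0%R, 1%R[%classic : set R) by [].
  by rewrite lebesgue_measure_itv/= !lte_fin ltr01 oppr0 adde0 lte_fin.
have mf' : lebesgue_measurable_fun `]0, 1[%classic f.
  apply: (measurable_funS mI1) mf => x /=.
  by rewrite !in_itv/= => /andP[-> /ltW].
have [n [mA A0]] := positive_measure_bounded
  (mu := @completed_lebesgue_measure R) mI mf' I0.
exists (`]0, 1[ `&` [set x | `|f x| <= n%:R]); split => //.
split; [exists n%:R|exists (- n%:R)] => _ [x [_ /= fx] <-].
  by apply: le_trans fx; exact: ler_norm.
by move: fx; rewrite ler_norml => /andP[].
Qed.

(** * Additive functions bounded on a set of positive measure *)

(** By [affine_steinhaus] with [al = -1], every point near the density point [p]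
    of [B] is the midpoint of two points of [B], and so [a] is bounded above on
    a whole neighbourhood of [p].  Writing [a (p + h) = a p + a h] and
    [a p = a (p - h) + a h] turns this one-sided bound into a two-sided bound on
    [a] near 0. *)
Lemma additive_on_unit_linear_of_ubound (R : realType) (a : R -> R)
    (B : set R) (M : R) :
  additive_on_unit a -> measurable B -> (0 < lebesgue_measure B)%E ->
  B `<=` `]0, 1[ -> (forall x, B x -> a x <= M) ->
  forall x, 0 < x <= 1 -> a x = a 1 * x.
Proof.
move=> ha mB B0 B01 BM.
have [p [e [Bp e0 He]]] := affine_steinhaus mB B0.
have unitB x : B x -> 0 < x < 1 by move/B01; rewrite /= in_itv.
have p01 := unitB _ Bp.
(* The points [x] and [y] of [B] with midpoint [p + h] are exchanged by the
   reflection in [p + h], which moves [p] by [2 * h]. *)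
pose d := e / 2.
have near_p h : `|h| <= d -> 0 < p + h < 1 /\ a (p + h) <= M.
  move=> hd; have := He (-1) (2 * p + 2 * h).
  have -> : -1 * p + (2 * p + 2 * h) - p = 2 * h by ring.
  rewrite normrN normr1 lexx andbT normrM ger0_norm// => {}He.
  have : (0 < lebesgue_measure
    (B `&` (fun x => -1 * x + (2 * p + 2 * h))%R @^-1` B))%E.
    by apply: He; move: hd; rewrite /d; lra.
  case: (pselect (exists x, B x /\ B (-1 * x + (2 * p + 2 * h)))); last first.
    move=> nex; suff -> : B `&` (fun x => -1 * x + (2 * p + 2 * h))%R @^-1` B
      = set0 by rewrite measure0 ltxx.
    by apply/seteqP; split => // x [Bx Tx]; apply: nex; exists x.
  move=> [x [Bx By]] _; set y := (X in B X) in By.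
  clear He B0; have x01 := unitB _ Bx; have y01 := unitB _ By.
  have phE : p + h = 2^-1 * x + 2^-1 * y by rewrite /y; field.
  split; first by rewrite phE; lra.
  rewrite phE ha; [|lra..].
  have [x01' y01'] : 0 < x <= 1 /\ 0 < y <= 1 by lra.
  rewrite (additive_on_unit_half ha x01') (additive_on_unit_half ha y01').
  by have := BM _ Bx; have := BM _ By; lra.
have [_ ap] := near_p 0 ltac:(rewrite normr0 /d; lra).
apply: (@additive_on_unit_linear _ _ d (M - a p) ha); first by rewrite /d; lra.
move=> h hd.
have [h1 ah1] := near_p h ltac:(rewrite ger0_norm; lra).
have [h2 ah2] := near_p (- h) ltac:(rewrite normrN ger0_norm; lra).
have e1 : a (p + h) = a p + a h by apply: ha; lra.
have e2 : a p = a (p - h) + a h by rewrite -[in LHS](subrK h p) [LHS]ha //; lra.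
by rewrite ler_norml; lra.
Qed.

(** * The equation and its homogeneity defects *)

Definition homogeneity_defect (R : realType) (q : R) (f : R -> R)
    (t x : R) : R :=
  f (t * x) - t `^ q * f x.

Lemma entropy_equation1 (R : realType) (q : R) (f : R -> R) :
  entropy_equation q f -> f 1 = 0.
Proof.
move=> hf; have := hf 2^-1 1 ltac:(lra) ltac:(lra).
by rewrite powR1 !mulr1; lra.
Qed.

(** The Cauchy difference of [f] is homogeneous of degree [q], as one sees on
    comparing the equation at [(u / (u + v), u + v)] and at
    [(u / (u + v), t * (u + v))]. *)
Lemma additive_homogeneity_defect (R : realType) (q : R) (f : R -> R) (t : R) :
  entropy_equation q f -> 0 < t <= 1 ->
  additive_on_unit (homogeneity_defect q f t).
Proof.
move=> hf t01 u v u0 v0 uv.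
have uv0 : 0 < u + v by lra.
have x01 : 0 < u / (u + v) < 1.
  by rewrite divr_gt0//= ltr_pdivrMr//; lra.
have y01 : 0 < t * (u + v) <= 1.
  by rewrite mulr_gt0 ?mulr_ile1//; lra.
have := hf _ _ x01 y01; have := hf _ (u + v) x01 ltac:(lra).
have -> : u / (u + v) * (u + v) = u by field; lra.
have -> : (1 - u / (u + v)) * (u + v) = v by field; lra.
have -> : u / (u + v) * (t * (u + v)) = t * u by field; lra.
have -> : (1 - u / (u + v)) * (t * (u + v)) = t * v by field; lra.
rewrite powRM; [|lra..] => e1 e2.
rewrite /homogeneity_defect.
have e1' : t `^ q * (f u + f v - f (u + v)) = t `^ q *
  ((f (u / (u + v)) + f (1 - u / (u + v))) * (u + v) `^ q) by rewrite e1.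
by lra.
Qed.

(** * Exponents different from 1 *)

(** Computing [f (r * t)] by the defect of [r] and by that of [t], and using
    [A_t r = r * A_t 1] for the rational number [r = 1 / 2], gives a linear
    equation for [f t] whose coefficient [r - r `^ q] is nonzero as [q <> 1]. *)
Lemma entropy_equation_power (R : realType) (q : R) (f : R -> R) :
  q <> 1 -> entropy_equation q f ->
  exists2 a : R -> R, additive_on_unit a &
    forall t, 0 < t <= 1 -> f t = a t - a 1 * t `^ q.
Proof.
move=> q1 hf; pose r : R := 2^-1.
have r01 : 0 < r <= 1 by rewrite /r; lra.
have rq : r - r `^ q != 0.
  rewrite subr_eq0; apply/negP => /eqP rE; apply: q1.
  have : ln r = q * ln r by rewrite {1}rE ln_powR.
  have : ln r < 0 by apply: ln_lt0; rewrite /r; lra.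
  move=> r0 /esym/eqP; rewrite -[X in _ == X]mul1r => /eqP/mulIf.
  by apply; rewrite lt_eqF.
pose a x := (r - r `^ q)^-1 * homogeneity_defect q f r x.
have aA := additive_homogeneity_defect hf r01.
exists a => [u v u0 v0 uv|t t01].
  by rewrite /a aA// mulrDr.
have := additive_on_unit_half (additive_homogeneity_defect hf t01)
  (u := 1) ltac:(lra).
rewrite -/r /a /homogeneity_defect !mulr1 (entropy_equation1 hf) !mulr0 !subr0.
rewrite (mulrC t) => e.
have -> : f (r * t) = r * f t + t `^ q * f r by lra.
by field.
Qed.

(** The additive part [a] of [f] inherits the one-sided bound of [f] on the
    points of [A] where [x `^ q] is bounded.  A lower bound is treated as an
    upper bound of [- a]. *)
Lemma entropy_equation_linear_power (R : realType) (q : R) (f : R -> R)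
    (A : set R) :
  q <> 1 -> entropy_equation q f ->
  A `<=` `]0, 1[ -> positive_lebesgue_measure A ->
  has_ubound (f @` A) \/ has_lbound (f @` A) ->
  exists c cstar : R, forall x, 0 < x < 1 -> f x = cstar * x + c * x `^ q.
Proof.
move=> q1 hf A01 A0 fb; have [a ha fa] := entropy_equation_power q1 hf.
suff alin x : 0 < x <= 1 -> a x = a 1 * x.
  exists (- a 1), (a 1) => x /andP[x0 /ltW x1].
  by rewrite fa ?x0// (alin x) ?x0//; ring.
have [B0 [mB0 B0A B00]] := positive_lebesgue_borel_subset A0.
have mpow : measurable_fun B0 (fun x : R => x `^ q : measurableTypeR R).
  by apply: measurable_funTS; exact: measurable_powR.
have [n [mB Bpos]] := positive_measure_bounded
  (mu := @lebesgue_measure R) mB0 mpow B00.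
clear A0 mB0 mpow B00.
set B := _ `&` _ in mB Bpos.
have B01 : B `<=` `]0, 1[ by move=> y [/B0A/A01].
have Bbnd y : B y -> `|a 1 * y `^ q| <= `|a 1| * n%:R.
  by move=> [_ xn]; rewrite normrM ler_wpM2l.
have fB y : B y -> a y = f y + a 1 * y `^ q.
  move=> By; rewrite fa; first by ring.
  by move/B01 : By => /=; rewrite in_itv/= => /andP[-> /ltW].
have BfA y : B y -> (f @` A) (f y) by move=> [/B0A Ay _]; exists y.
move=> x01; case: fb => -[M fM].
  apply: (additive_on_unit_linear_of_ubound (M := M + `|a 1| * n%:R)
    ha mB Bpos B01) => //.
  move=> y By; rewrite fB//; apply: lerD; first exact/fM/BfA.
  by apply: le_trans (Bbnd _ By); exact: ler_norm.
pose a' x := - a x.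
have ha' : additive_on_unit a' by move=> u v u0 v0 uv; rewrite /a' ha// opprD.
suff : a' x = a' 1 * x by rewrite /a'; lra.
apply: (additive_on_unit_linear_of_ubound (M := - M + `|a 1| * n%:R)
  ha' mB Bpos B01) => //.
move=> y By; rewrite /a' fB// opprD; apply: lerD.
  by rewrite lerN2; exact/fM/BfA.
by apply: le_trans (Bbnd _ By); rewrite -normrN; exact: ler_norm.
Qed.

(** * Exponent 1 *)

(** The Leibniz rule for one fixed factor [t]: it says that the degree 1
    homogeneity defect of [t] is the linear map [x |-> f t * x]. *)
Definition derivation_at (R : realType) (f : R -> R) (t : R) : Prop :=
  forall x, 0 < x <= 1 -> f (t * x) = t * f x + x * f t.

Lemma derivation_at_exp (R : realType) (f : R -> R) (t : R) (n : nat) :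
  0 < t <= 1 -> f 1 = 0 -> derivation_at f t -> derivation_at f (t ^+ n).
Proof.
move=> t01 f1 ft; elim: n => [|n IH] x x01.
  by rewrite expr0 f1 !mul1r; ring.
have tn01 : 0 < t ^+ n <= 1.
  by rewrite exprn_gt0 ?exprn_ile1//; lra.
rewrite exprS -mulrA ft; last first.
  by rewrite mulr_gt0 ?mulr_ile1//; lra.
by rewrite IH// (ft (t ^+ n))//; ring.
Qed.

(** For [t] near 1 the set of the [x] in [B] with [t * x] in [B] has positive
    measure, and there the homogeneity defect of [t] is bounded.  The point [x]
    in the conclusion serves to bound [f t] itself. *)
Lemma entropy_equation_derivation_at (R : realType) (f : R -> R) (B : set R)
    (M : R) :
  entropy_equation 1 f -> measurable B -> (0 < lebesgue_measure B)%E ->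
  B `<=` `]0, 1[ -> (forall x, B x -> `|f x| <= M) ->
  exists e : R, [/\ 0 < e, e < 1 & forall t, 1 - e <= t <= 1 ->
    derivation_at f t /\ exists x, B x /\ B (t * x)].
Proof.
move=> hf mB B0 B01 fM.
have [p [e0 [Bp e00 He]]] := affine_steinhaus mB B0.
pose e := Num.min e0 2^-1.
have ee0 : e <= e0 by rewrite ge_min lexx.
have e2 : e <= 2^-1 by rewrite ge_min lexx orbT.
have e_gt0 : 0 < e by rewrite lt_min e00; lra.
have unitB x : B x -> 0 < x < 1 by move/B01; rewrite /= in_itv.
have p01 := unitB _ Bp.
exists e; split=> [//||t te]; first lra.
have t01 : 0 < t <= 1 by lra.
pose E := B `&` (fun x => t * x + 0) @^-1` B.
have Epos : (0 < lebesgue_measure E)%E.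
  apply: He; first by rewrite ger0_norm; lra.
  have -> : t * p + 0 - p = (t - 1) * p by ring.
  rewrite normrM ler0_norm ?ger0_norm; [|lra..].
  by apply: le_trans (_ : - (t - 1) * 1 <= _); [apply: ler_wpM2l; lra|lra].
have mE : measurable E.
  apply: measurableI => //; rewrite -[X in measurable X]setTI.
  exact: measurable_affine.
have EB x : E x -> B x /\ B (t * x) by move=> [Bx]; rewrite /= addr0.
split; last first.
  have [x Ex] : exists x, E x.
    apply: contrapT => H; move: Epos.
    suff -> : E = set0 by rewrite measure0 ltxx.
    by apply/seteqP; split => // x Ex; apply: H; exists x.
  by exists x; exact: EB.
have lin := @additive_on_unit_linear_of_ubound _ _ E (M + M)
  (additive_homogeneity_defect hf t01) mE Epos.
move=> x x01; have := lin _ _ x x01.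
rewrite /homogeneity_defect mulr1 (entropy_equation1 hf) powRr1; last by lra.
rewrite mulr0 subr0 => {}lin; suff : f (t * x) - t * f x = f t * x by lra.
apply: lin => [y /EB[/B01]//|y /EB[By Bty]].
apply: lerD; first by apply: le_trans (fM _ Bty); exact: ler_norm.
apply: le_trans (ler_norm _) _; rewrite normrN normrM.
apply: le_trans (fM _ By); rewrite ler_piMl//.
by rewrite ger0_norm; lra.
Qed.

(** The function [L s := f (exp (- s)) / exp (- s)] is additive on the
    nonnegative reals, because the Leibniz rule passes from the factors near 1
    to their powers, hence to all factors in ]0,1].  It is bounded near 0,
    because [L s] is the difference of the values of [f x / x] at two points of
    [B].  So [L] is linear. *)
Lemma entropy_equation_xlnx (R : realType) (f : R -> R) (A : set R) :
  entropy_equation 1 f ->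
  A `<=` `]0, 1[ -> positive_lebesgue_measure A ->
  has_ubound (f @` A) /\ has_lbound (f @` A) ->
  exists c : R, forall x, 0 < x < 1 -> f x = c * x * ln x.
Proof.
move=> hf A01 A0 [[M1 fM1] [M2 fM2]].
have f1 := entropy_equation1 hf.
have [B0 [mB0 B0A B00]] := positive_lebesgue_borel_subset A0.
have minv : measurable_fun B0 (fun x : R => x `^ (-1) : measurableTypeR R).
  by apply: measurable_funTS; exact: measurable_powR.
have [n [mB Bpos]] := positive_measure_bounded
  (mu := @lebesgue_measure R) mB0 minv B00.
clear A0 mB0 minv B00.
set B := _ `&` _ in mB Bpos.
have B01 : B `<=` `]0, 1[ by move=> y [/B0A/A01].
have unitB x : B x -> 0 < x < 1 by move/B01; rewrite /= in_itv.
pose M := `|M1| + `|M2|.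
have BfA x : B x -> (f @` A) (f x) by move=> [/B0A Ax _]; exists x.
have fM x : B x -> `|f x| <= M.
  move=> Bx; have := fM1 _ (BfA _ Bx); have := fM2 _ (BfA _ Bx).
  rewrite /M ler_norml; have := ler_norm M1; have := ler_norm (- M2).
  by rewrite normrN; have := normr_ge0 M1; have := normr_ge0 M2; lra.
have [e [e0 e1 He]] := entropy_equation_derivation_at hf mB Bpos B01 fM.
clear mB Bpos.
pose l x := f x / x.
have lM x : B x -> `|l x| <= M * n%:R.
  move=> Bx; rewrite /l normrM; apply: ler_pM => //; first exact: fM.
  have /andP[/ltW x0 _] := unitB _ Bx.
  by case: Bx => _ /=; rewrite powR_inv1.
have fexp s : 0 <= s -> derivation_at f (expR (- s)).
  move=> s0; pose k := (Num.bound (s / e)).+1.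
  have ks : s / k%:R <= e.
    rewrite ler_pdivrMr ?ltr0n// mulrC -ler_pdivrMr//.
    apply: ltW; apply: lt_le_trans (archi_boundP _) _.
      by rewrite divr_ge0// ltW.
    by rewrite ler_nat.
  have sk0 : 0 <= s / k%:R by rewrite divr_ge0.
  have -> : expR (- s) = expR (- (s / k%:R)) ^+ k.
    by rewrite -expRM_natl; congr expR; field; rewrite pnatr_eq0.
  apply: derivation_at_exp => //.
    by rewrite expR_gt0 -[leRHS]expR0 ler_expR oppr_le0.
  apply: (He _ _).1; rewrite -[X in _ && (_ <= X)]expR0 ler_expR oppr_le0 sk0 andbT.
  by apply: le_trans (expR_ge1Dx _); lra.
have expN01 (s : R) : 0 <= s -> 0 < expR (- s) <= 1.
  by move=> s0; rewrite expR_gt0 -[leRHS]expR0 ler_expR oppr_le0.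
pose L s := l (expR (- s)).
have LD s s' : 0 <= s -> 0 <= s' -> L (s + s') = L s + L s'.
  move=> s0 s0'; rewrite /L /l opprD expRD (fexp _ s0 _ (expN01 _ s0')).
  by field; rewrite !gt_eqF ?expR_gt0.
have LM s : 0 < s < e -> `|L s| <= M * n%:R + M * n%:R.
  move=> se; have [|dt [x [Bx Btx]]] := He (expR (- s)).
    have := expN01 s ltac:(lra); have := expR_ge1Dx (- s); lra.
  have x01 := unitB _ Bx.
  have -> : L s = l (expR (- s) * x) - l x.
    rewrite /L /l dt; last by lra.
    by field; rewrite !gt_eqF ?expR_gt0//; lra.
  by apply: le_trans (ler_normB _ _) _; apply: lerD; exact: lM.
(* Linearity on ]0,1] is applied to the rescaled functions [u |-> L (S * u)],
   in order to reach all arguments. *)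
have Llin S : 0 < S -> forall u, 0 < u <= 1 -> L (S * u) = L S * u.
  move=> S0 u u01.
  have := @additive_on_unit_linear _ (fun u => L (S * u)) (e / S)
    (M * n%:R + M * n%:R).
  rewrite mulr1; apply => //.
  - by move=> v w v0 w0 _; rewrite mulrDr LD// mulr_ge0//; lra.
  - by rewrite divr_gt0.
  - move=> h /andP[h0 hS]; apply: LM; rewrite mulr_gt0//=.
    by move: hS; rewrite ltr_pdivlMr// mulrC.
have L1 s : 0 < s -> L s = L 1 * s.
  move=> s0; have [s1|s1] := leP s 1.
    by have := Llin 1 ltr01 s; rewrite mul1r; apply; lra.
  have := Llin s s0 s^-1; rewrite mulfV ?gt_eqF// invr_gt0 s0 invf_le1// ltW//.
  by move=> /(_ isT) ->; field; lra.
exists (- L 1) => x x01.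
have lx : 0 < - ln x by rewrite oppr_gt0 ln_lt0.
have := L1 _ lx; rewrite {1}/L /l opprK lnK; last by rewrite posrE; lra.
move=> /(congr1 ( *%R^~ x)); rewrite divfK; last by rewrite gt_eqF; lra.
by move=> ->; ring.
Qed.

(** * The solutions *)

Theorem corollary2p2 (R : realType) (q : R) (f : R -> R)
    (hf : entropy_equation q f) :
  (q <> 1 ->
   ((exists A : set R, [/\ A `<=` `]0, 1[%classic,
        positive_lebesgue_measure A &
        has_ubound (f @` A) \/ has_lbound (f @` A)])
    \/ lebesgue_measurable_fun `]0, 1]%classic f) ->
   exists c cstar : R,
     (forall x : R, 0 < x < 1 -> f x = cstar * x + c * x `^ q) /\ f 1 = 0)
  /\
  (q = 1 ->
   ((exists A : set R, [/\ A `<=` `]0, 1[%classic,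
        positive_lebesgue_measure A &
        has_ubound (f @` A) /\ has_lbound (f @` A)])
    \/ lebesgue_measurable_fun `]0, 1]%classic f) ->
   exists c cstar : R,
     (forall x : R, 0 < x < 1 -> f x = c * x * ln x + cstar * x) /\ f 1 = 0).
Proof.
have f1 := entropy_equation1 hf.
split=> [q1 hyp|q1 hyp].
  have [A [A01 A0 fA]] : exists A : set R, [/\ A `<=` `]0, 1[%classic,
      positive_lebesgue_measure A & has_ubound (f @` A) \/ has_lbound (f @` A)].
    case: hyp => // /lebesgue_measurable_bounded[A [A01 A0 [ub _]]].
    by exists A; split => //; left.
  have [c [cstar fE]] := entropy_equation_linear_power q1 hf A01 A0 fA.
  by exists c, cstar.
have [A [A01 A0 fA]] : exists A : set R, [/\ A `<=` `]0, 1[%classic,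
    positive_lebesgue_measure A & has_ubound (f @` A) /\ has_lbound (f @` A)].
  by case: hyp => // /lebesgue_measurable_bounded.
rewrite q1 in hf; have [c fE] := entropy_equation_xlnx hf A01 A0 fA.
by exists c, 0; split => // x /fE ->; rewrite mul0r addr0.
Qed.
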